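(* Let $d\ge 1$ and let $(\mathscr{C},\Sigma^d,\Theta)$ be a $(d+2)$-angulated category with $d$-suspension functor $\Sigma^d$ and with a right Serre functor $\mathbb{S}\colon\mathscr{C}\to\mathscr{C}$. Then there exists a natural isomorphism $\zeta\colon\mathbb{S}\Sigma^d\to\Sigma^d\mathbb{S}$ such that $\mathbb{S}$ (together with $\zeta$) is a $(d+2)$-angulated functor.
   Context: Throughout, $k$ is an algebraically closed field and all categories are $k$-linear, Hom-finite and Krull-Schmidt; $(-)^{\ast}=\operatorname{Hom}_k(-,k)$. **$(d+2)$-angulated category.** Let $d\ge 1$ be an integer, $\mathscr{C}$ an additive category and $\Sigma^d\colon\mathscr{C}\to\mathscr{C}$ an automorphism (the $d$-suspension functor; $\Sigma^d$ is a single symbol), with inverse $\Sigma^{-d}$. A $(d+2)$-$\Sigma^d$-sequence is a sequence of morphisms $A_0\xrightarrow{f_0}A_1\xrightarrow{f_1}\cdots\xrightarrow{f_d}A_{d+1}\xrightarrow{f_{d+1}}\Sigma^dA_0$. Its left rotation is $A_1\xrightarrow{f_1}\cdots\xrightarrow{f_d}A_{d+1}\xrightarrow{f_{d+1}}\Sigma^dA_0\xrightarrow{(-1)^d\Sigma^df_0}\Sigma^dA_1$. A morphism from it to $B_0\xrightarrow{g_0}\cdots\xrightarrow{g_d}B_{d+1}\xrightarrow{g_{d+1}}\Sigma^dB_0$ is a tuple $(\varphi_0,\dots,\varphi_{d+1})$, $\varphi_i\colon A_i\to B_i$, with $\varphi_{i+1}f_i=g_i\varphi_i$ for $0\le i\le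 d$ and $\Sigma^d\varphi_0\circ f_{d+1}=g_{d+1}\varphi_{d+1}$. The triple $(\mathscr{C},\Sigma^d,\Theta)$, with $\Theta$ a class of such sequences (called $(d+2)$-angles), is a $(d+2)$-angulated category if: (N1) $\Theta$ is closed under isomorphisms, direct sums and direct summands; for each $A$ the sequence $A\xrightarrow{\mathrm{Id}}A\to0\to\cdots\to0\to\Sigma^dA$ is in $\Theta$; every morphism $f_0\colon A_0\to A_1$ is the first morphism of some $(d+2)$-angle. (N2) A sequence is in $\Theta$ if and only if its left rotation is in $\Theta$. (N3) Given two $(d+2)$-angles $A_0\xrightarrow{f_0}A_1\xrightarrow{f_1}\cdots\xrightarrow{f_d}A_{d+1}\xrightarrow{f_{d+1}}\Sigma^dA_0$ and $B_0\xrightarrow{g_0}B_1\xrightarrow{g_1}\cdots\xrightarrow{g_d}B_{d+1}\xrightarrow{g_{d+1}}\Sigma^dB_0$ and morphisms $\varphi_0\colon A_0\to B_0$, $\varphi_1\colon A_1\to B_1$ with $\varphi_1f_0=g_0\varphi_0$, there are $\varphi_2,\dots,\varphi_{d+1}$ making $(\varphi_0,\dots,\varphi_{d+1})$ a morphism from the first $(d+2)$-angle to the second. (N4) In (N3) the morphisms $\varphi_2,\dots,\varphi_{d+1}$ can be chosen so that the mapping cone $A_1\oplus B_0\to A_2\oplus B_1\to\cdots\to A_{d+1}\oplus B_d\to\Sigma^dA_0\oplus B_{d+1}\to\Sigma^dA_1\oplus\Sigma^dB_0$ is in $\Theta$, where the maps are $\begin{pmatrix}-f_i&0\\ \varphi_i&g_{i-1}\end{pmatrix}$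 for $i=1,\dots,d+1$ followed by $\begin{pmatrix}-\Sigma^df_0&0\\ \Sigma^d\varphi_0&g_{d+1}\end{pmatrix}$. **Right Serre functor.** A right Serre functor on $\mathscr{C}$ is a $k$-linear additive functor $\mathbb{S}\colon\mathscr{C}\to\mathscr{C}$ together with isomorphisms $\eta_{A,B}\colon\operatorname{Hom}(A,B)\to\operatorname{Hom}(B,\mathbb{S}A)^{\ast}$ for all $A,B\in\mathscr{C}$, natural in $A$ and $B$. **$(d+2)$-angulated functor.** A covariant additive functor $F\colon\mathscr{C}\to\mathscr{C}$ together with a natural isomorphism $\phi\colon F\Sigma^d\to\Sigma^dF$ is a $(d+2)$-angulated functor if for every $(d+2)$-angle $A_0\xrightarrow{f_0}A_1\xrightarrow{f_1}\cdots\xrightarrow{f_d}A_{d+1}\xrightarrow{f_{d+1}}\Sigma^dA_0$ in $\mathscr{C}$ the sequence $FA_0\xrightarrow{F(f_0)}FA_1\xrightarrow{F(f_1)}\cdots\xrightarrow{F(f_d)}FA_{d+1}\xrightarrow{\phi_{A_0}\circ F(f_{d+1})}\Sigma^dFA_0$ is a $(d+2)$-angle in $\mathscr{C}$. *)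

(* Defs.v *)
From HB Require Import structures.
From mathcomp Require Import all_boot all_order all_algebra.

Set Implicit Arguments.
Unset Strict Implicit.
Unset Printing Implicit Defensive.

Import GRing.Theory.
Local Open Scope ring_scope.

(* Hom-finite k-linear additive categories. Hom-finiteness is carried by the
   type vectType k of the Hom spaces; the zero object and the biproduct of two
   objects are chosen. *)
Record addcat (k : fieldType) := AddCat {
  Ob :> Type;
  Mor : Ob -> Ob -> vectType k;
  idmor : forall A, Mor A A;
  compmor : forall A B D, Mor B D -> Mor A B -> Mor A D;
  comp1m : forall A B (f : Mor A B), compmor (idmor B) f = f;
  compm1 : forall A B (f : Mor A B), compmor f (idmor A) = f;
  compA : forall A B D E (h : Mor D E) (g : Mor B D) (f : Mor A B),
    compmor h (compmor g f) = compmor (compmor h g) f;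
  comp_linearl : forall A B D (f : Mor A B),
    linear (fun g : Mor B D => compmor g f);
  comp_linearr : forall A B D (g : Mor B D),
    linear (fun f : Mor A B => compmor g f);
  zob : Ob;
  zob_initial : forall A (f : Mor zob A), f = 0;
  zob_terminal : forall A (f : Mor A zob), f = 0;
  bip : Ob -> Ob -> Ob;
  in1 : forall A B, Mor A (bip A B);
  in2 : forall A B, Mor B (bip A B);
  pr1 : forall A B, Mor (bip A B) A;
  pr2 : forall A B, Mor (bip A B) B;
  pr1_in1 : forall A B, compmor (pr1 A B) (in1 A B) = idmor A;
  pr2_in2 : forall A B, compmor (pr2 A B) (in2 A B) = idmor B;
  pr1_in2 : forall A B, compmor (pr1 A B) (in2 A B) = 0;
  pr2_in1 : forall A B, compmor (pr2 A B) (in1 A B) = 0;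
  in_pr : forall A B,
    compmor (in1 A B) (pr1 A B) + compmor (in2 A B) (pr2 A B) = idmor (bip A B)
}.

Arguments Mor {k a} A B.
Arguments idmor {k a} A.
Arguments compmor {k a A B D} g f.
Arguments zob {k} a.
Arguments bip {k a} A B.
Arguments in1 {k a} A B.
Arguments in2 {k a} A B.
Arguments pr1 {k a} A B.
Arguments pr2 {k a} A B.

Notation "g \c f" := (compmor g f) (at level 40, left associativity).
Notation "A (+) B" := (bip A B) (at level 50, left associativity).

Section Categories.
Variables (k : fieldType) (C : addcat k).
Implicit Types A B : C.

Definition is_iso A B (f : Mor A B) : Prop :=
  exists g : Mor B A, g \c f = idmor A /\ f \c g = idmor B.

(* The endomorphism ring of A is local: it is nonzero and its non-invertible
   elements are closed under addition. *)
Definition local_end A : Prop :=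
  idmor A <> 0 /\
  forall f g : Mor A A, ~ is_iso f -> ~ is_iso g -> ~ is_iso (f + g).

Definition krull_schmidt : Prop :=
  forall A, exists (n : nat) (X : 'I_n -> C),
    (forall i, local_end (X i)) /\
    exists f : Mor A (\big[bip/zob C]_(i < n) X i), is_iso f.

(* The map with matrix
     ( a b )
     ( c e ). *)
Definition bmat A B A' B' (a : Mor A A') (b : Mor B A')
    (c : Mor A B') (e : Mor B B') : Mor (A (+) B) (A' (+) B') :=
  in1 A' B' \c (a \c pr1 A B + b \c pr2 A B)
  + in2 A' B' \c (c \c pr1 A B + e \c pr2 A B).

Record functor := Functor {
  fobj :> C -> C;
  fmap : forall A B, Mor A B -> Mor (fobj A) (fobj B);
  fmap1 : forall A, fmap (idmor A) = idmor (fobj A);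
  fmapM : forall A B D (g : Mor B D) (f : Mor A B),
    fmap (g \c f) = fmap g \c fmap f
}.

Definition additive_functor (F : functor) : Prop :=
  forall A B (f g : Mor A B), fmap F (f + g) = fmap F f + fmap F g.

Definition linear_functor (F : functor) : Prop :=
  forall A B, linear (@fmap F A B).

Lemma fcomp1 (G F : functor) A : fmap G (fmap F (idmor A)) = idmor (G (F A)).
Proof. by rewrite !fmap1. Qed.

Lemma fcompM (G F : functor) A B D (g : Mor B D) (f : Mor A B) :
  fmap G (fmap F (g \c f)) = fmap G (fmap F g) \c fmap G (fmap F f).
Proof. by rewrite !fmapM. Qed.

Definition fcomp (G F : functor) : functor :=
  @Functor (fun A => G (F A)) (fun A B f => fmap G (fmap F f))
    (fcomp1 G F) (@fcompM G F).

Definition natural_iso (F G : functor) (phi : forall A, Mor (F A) (G A)) : Prop :=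
  (forall A, is_iso (phi A)) /\
  forall A B (f : Mor A B), phi B \c fmap F f = fmap G f \c phi A.

(* A morphism packed with its source and target, so that an equality of arrows
   includes the equalities of the sources and of the targets. *)
Record arrow := Arrow { src : C; tgt : C; arr : Mor src tgt }.

Definition amap (F : functor) (x : arrow) : arrow := Arrow (fmap F (arr x)).

(* k-linear automorphisms (strict isomorphisms of categories). *)
Record automorphism := Automorphism {
  aut :> functor;
  aut_inv : functor;
  aut_linear : linear_functor aut;
  autK : cancel (amap aut) (amap aut_inv);
  autVK : cancel (amap aut_inv) (amap aut)
}.

(* The dual of V is 'Hom(V, k^o). *)
Record right_serre := RightSerre {
  serre :> functor;
  serre_linear : linear_functor serre;
  eta : forall A B, {linear Mor A B -> 'Hom(Mor B (serre A), k^o)};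
  eta_bij : forall A B, bijective (eta A B);
  eta_naturalr : forall A B B' (b : Mor B B') (f : Mor A B)
    (h : Mor B' (serre A)), eta A B' (b \c f) h = eta A B f (h \c b);
  eta_naturall : forall A A' B (a : Mor A' A) (f : Mor A B)
    (h : Mor B (serre A')),
    eta A' B (f \c a) h = eta A B f (fmap serre a \c h)
}.

(* [chain n A E] is the type of sequences of n.+1 composable morphisms
   A -> X_1 -> ... -> X_n -> E. *)
Fixpoint chain (n : nat) (A E : C) : Type :=
  if n is m.+1 then {B : C & (Mor A B * chain m B E)%type} else Mor A E.

Definition ccons n A B E (f : Mor A B) (c : chain n B E) : chain n.+1 A E :=
  existT _ B (f, c).

Definition cmid n A E (c : chain n.+1 A E) : C := projT1 c.
Definition chead n A E (c : chain n.+1 A E) : Mor A (cmid c) := (projT2 c).1.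
Definition ctail n A E (c : chain n.+1 A E) : chain n (cmid c) E := (projT2 c).2.

Fixpoint csnoc n A E T : chain n A E -> Mor E T -> chain n.+1 A T :=
  match n return chain n A E -> Mor E T -> chain n.+1 A T with
  | 0 => fun f h => @ccons 0 A E T f h
  | m.+1 => fun c h => ccons (chead c) (csnoc (ctail c) h)
  end.

Fixpoint cpost n A E T : chain n A E -> Mor E T -> chain n A T :=
  match n return chain n A E -> Mor E T -> chain n A T with
  | 0 => fun f h => h \c f
  | m.+1 => fun c h => ccons (chead c) (cpost (ctail c) h)
  end.

Fixpoint cmap (F : functor) n A E : chain n A E -> chain n (F A) (F E) :=
  match n return chain n A E -> chain n (F A) (F E) with
  | 0 => fun f => fmap F f
  | m.+1 => fun c => ccons (fmap F (chead c)) (cmap F (ctail c))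
  end.

Fixpoint czero n A E : chain n A E :=
  match n return chain n A E with
  | 0 => 0
  | m.+1 => ccons (0 : Mor A (zob C)) (czero m (zob C) E)
  end.

Fixpoint csum n A E A' E' :
    chain n A E -> chain n A' E' -> chain n (A (+) A') (E (+) E') :=
  match n return
    chain n A E -> chain n A' E' -> chain n (A (+) A') (E (+) E') with
  | 0 => fun f f' => bmat f 0 0 f'
  | m.+1 => fun c c' =>
      ccons (bmat (chead c) 0 0 (chead c')) (csum (ctail c) (ctail c'))
  end.

(* Families of maps X_i -> X'_i, 1 <= i <= n, between the inner objects of two
   chains; the maps between the end points are kept separate. *)
Fixpoint cmaps n A E A' E' : chain n A E -> chain n A' E' -> Type :=
  match n return chain n A E -> chain n A' E' -> Type with
  | 0 => fun _ _ => unit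
  | m.+1 => fun c c' =>
      (Mor (cmid c) (cmid c') * cmaps (ctail c) (ctail c'))%type
  end.

Fixpoint cmaps_commute n A E A' E' :
    forall (c : chain n A E) (c' : chain n A' E'),
    Mor A A' -> Mor E E' -> cmaps c c' -> Prop :=
  match n return forall (c : chain n A E) (c' : chain n A' E'),
    Mor A A' -> Mor E E' -> cmaps c c' -> Prop with
  | 0 => fun f f' a e _ => e \c f = f' \c a
  | m.+1 => fun c c' a e phi =>
      phi.1 \c chead c = chead c' \c a /\ cmaps_commute phi.1 e phi.2
  end.

Fixpoint cmaps_iso n A E A' E' :
    forall (c : chain n A E) (c' : chain n A' E'), cmaps c c' -> Prop :=
  match n return
    forall (c : chain n A E) (c' : chain n A' E'), cmaps c c' -> Prop with
  | 0 => fun _ _ _ => True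
  | m.+1 => fun c c' phi => is_iso phi.1 /\ cmaps_iso phi.2
  end.

(* For c = (X_0 -f_0-> ... -f_n-> X_(n+1)), g : B -> Y_0,
   c' = (Y_0 -g_0-> ... -g_n-> Y_(n+1)), h : X_(n+1) -> T and maps
   a, phi_1, ..., phi_n, e from the X_i to the Y_i, this is the chain
   X_0 (+) B -> X_1 (+) Y_0 -> ... -> X_(n+1) (+) Y_n -> T (+) Y_(n+1) of maps
     ( -f_0 0 )    ( -f_i    0       )    ( -h 0   )
     ( a    g ),   ( phi_i   g_(i-1) ),   ( e  g_n ). *)
Fixpoint ccone n A E A' E' B T (g : Mor B A') (h : Mor E T) :
    forall (c : chain n A E) (c' : chain n A' E'),
    Mor A A' -> Mor E E' -> cmaps c c' -> chain n.+1 (A (+) B) (T (+) E') :=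
  match n return forall (c : chain n A E) (c' : chain n A' E'),
    Mor A A' -> Mor E E' -> cmaps c c' -> chain n.+1 (A (+) B) (T (+) E') with
  | 0 => fun f f' a e _ =>
      @ccons 0 _ _ _ (bmat (- f) 0 a g) (bmat (- h) 0 e f')
  | m.+1 => fun c c' a e phi =>
      ccons (bmat (- chead c) 0 a g) (ccone (chead c') h phi.1 e phi.2)
  end.

Section Angulated.
Variables (d : nat) (Sig : automorphism).

(* (d+2)-Sigma^d-sequences A_0 -> A_1 -> ... -> A_(d+1) -> Sigma^d A_0, with
   Sig playing the role of Sigma^d. *)
Record sigma_seq := SigmaSeq {
  sstart : C;
  schain : chain d.+1 sstart (Sig sstart)
}.

(* The canonical isomorphism Sigma^d A (+) Sigma^d B -> Sigma^d (A (+) B). *)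
Definition sig_bip A B : Mor (Sig A (+) Sig B) (Sig (A (+) B)) :=
  fmap Sig (in1 A B) \c pr1 (Sig A) (Sig B)
  + fmap Sig (in2 A B) \c pr2 (Sig A) (Sig B).

Definition left_rotation (X : sigma_seq) : sigma_seq :=
  SigmaSeq (csnoc (ctail (schain X))
                  ((-1) ^+ d *: fmap Sig (chead (schain X)))).

Definition seq_sum (X Y : sigma_seq) : sigma_seq :=
  SigmaSeq (cpost (csum (schain X) (schain Y))
                  (sig_bip (sstart X) (sstart Y))).

Definition seq_triv A : sigma_seq :=
  SigmaSeq (ccons (idmor A) (czero d A (Sig A))).

Definition seq_isomorphic (X Y : sigma_seq) : Prop :=
  exists (phi0 : Mor (sstart X) (sstart Y)) (phi : cmaps (schain X) (schain Y)),
    [/\ cmaps_commute phi0 (fmap Sig phi0) phi, is_iso phi0 & cmaps_iso phi].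

(* Here phi consists of phi_2, ..., phi_(d+1). *)
Definition mapping_cone A0 A1 B0 B1 (f0 : Mor A0 A1) (g0 : Mor B0 B1)
    (c : chain d A1 (Sig A0)) (c' : chain d B1 (Sig B0))
    (phi0 : Mor A0 B0) (phi1 : Mor A1 B1) (phi : cmaps c c') : sigma_seq :=
  SigmaSeq (cpost (ccone g0 (fmap Sig f0) phi1 (fmap Sig phi0) phi)
                  (sig_bip A1 B0)).

Record angulated (Theta : sigma_seq -> Prop) : Prop := Angulated {
  N1_iso : forall X Y, seq_isomorphic X Y -> Theta X -> Theta Y;
  N1_sum : forall X Y, Theta X -> Theta Y -> Theta (seq_sum X Y);
  N1_summand : forall X Y, Theta (seq_sum X Y) -> Theta X /\ Theta Y;
  N1_triv : forall A, Theta (seq_triv A);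
  N1_first : forall A0 A1 (f0 : Mor A0 A1),
    exists c : chain d A1 (Sig A0), Theta (SigmaSeq (ccons f0 c));
  N2 : forall X, Theta X <-> Theta (left_rotation X);
  N3 : forall A0 A1 B0 B1 (f0 : Mor A0 A1) (g0 : Mor B0 B1)
      (c : chain d A1 (Sig A0)) (c' : chain d B1 (Sig B0)),
    Theta (SigmaSeq (ccons f0 c)) -> Theta (SigmaSeq (ccons g0 c')) ->
    forall (phi0 : Mor A0 B0) (phi1 : Mor A1 B1), phi1 \c f0 = g0 \c phi0 ->
    exists phi : cmaps c c', cmaps_commute phi1 (fmap Sig phi0) phi;
  N4 : forall A0 A1 B0 B1 (f0 : Mor A0 A1) (g0 : Mor B0 B1)
      (c : chain d A1 (Sig A0)) (c' : chain d B1 (Sig B0)),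
    Theta (SigmaSeq (ccons f0 c)) -> Theta (SigmaSeq (ccons g0 c')) ->
    forall (phi0 : Mor A0 B0) (phi1 : Mor A1 B1), phi1 \c f0 = g0 \c phi0 ->
    exists phi : cmaps c c', cmaps_commute phi1 (fmap Sig phi0) phi /\
      Theta (mapping_cone f0 g0 phi0 phi1 phi)
}.

Definition seq_map (F : functor) (phi : forall A, Mor (F (Sig A)) (Sig (F A)))
    (X : sigma_seq) : sigma_seq :=
  SigmaSeq (cpost (cmap F (schain X)) (phi (sstart X))).

Definition angulated_functor (Theta : sigma_seq -> Prop) (F : functor)
    (phi : forall A, Mor (F (Sig A)) (Sig (F A))) : Prop :=
  [/\ additive_functor F,
      natural_iso (F := fcomp F Sig) (G := fcomp Sig F) phi
    & forall X, Theta X -> Theta (seq_map phi X)].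

End Angulated.
End Categories.

(* Main.v *)
Require Import Defs.
From HB Require Import structures.
From mathcomp Require Import all_boot all_order all_algebra.
From Stdlib Require Import Eqdep IndefiniteDescription.
Import Defs.

Set Implicit Arguments.
Unset Strict Implicit.
Unset Printing Implicit Defensive.

Import GRing.Theory.
Local Open Scope ring_scope.

(** Write tr : Hom(A, S A) -> k for the trace form of Serre duality, so that
    (f, h) |-> tr (h f) is a perfect pairing of Hom(A, W) with Hom(W, S A) and
    tr (h f) = tr (S f h) (trC). In particular a map h : W -> S A is determined
    by the traces tr (h b) for all b : A -> W (tr_ext).

    The commutation zeta : S Sigma -> Sigma S is the inverse of the isomorphism
    e_A : Sigma S A -> S Sigma A with tr (e_A (Sigma h)) = (-1)^d tr h
    (exists_serre_commutation). The sign compensates the one in the rotation of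
    angles.

    Let A_0 -> A_1 -> ... -> A_(d+1) -> Sigma A_0 be an angle with maps f_i.
    Angles are exact under Hom(W, -) and under Hom(-, W) (angle_pexact), and by
    duality the sequence of the S A_i is exact under Hom(W, -)
    (serre_weak_kernel). It is then also exact under Hom(-, W), because every
    map of the category has a weak kernel of which it is a weak cokernel
    (weak_kernel_exact2).

    Complete S f_0 to an angle S A_0 -> S A_1 -> X_2 -> ... -> X_(d+1) ->
    Sigma S A_0 with maps g_i, and compare it with the sequence of the S A_i
    (exists_serre_map). Maps X_i -> S A_i compatible with the maps of the two
    sequences and with the identity of Sigma S A_0 are obtained from right to
    left, by exactness, down to i = 3 (lift_chain). The last one,
    X_2 -> S A_2, has to satisfy two conditions, one on either side. By duality
    it is a linear functional on Hom(A_2, X_2) that is prescribed on two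
    subspaces (serre_extension), and the two prescriptions agree on common
    elements g_1 x = y f_2: the axiom N3 extends (x, y) to a morphism from the
    second rotation of the angle of the A_i to the first rotation of the angle
    of the X_i, and sliding the trace along this ladder transforms one
    prescription into the other (trace_slide).

    So there is a morphism from an angle to an exact sequence that is the
    identity at the objects S A_0 and S A_1. Such a morphism is in general not
    an isomorphism, but the two sequences become isomorphic once contractible
    summands W = W are added to both (weak_iso_invariant), and the class of
    angles is stable under adding and removing such summands (angle_invariant).
    Hence the sequence of the S A_i is an angle (serre_angle). *)

(** * Composition and biproducts *)

Section Categories.
Variables (k : fieldType) (C : addcat k).
Implicit Types A B D E F G T W X Y Z : C.

Lemma compDl A B D (g g' : Mor B D) (f : Mor A B) :
  (g + g') \c f = g \c f + g' \c f.
Proof. by have := comp_linearl f 1 g g'; rewrite !scale1r. Qed.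

Lemma compDr A B D (g : Mor B D) (f f' : Mor A B) :
  g \c (f + f') = g \c f + g \c f'.
Proof. by have := comp_linearr g 1 f f'; rewrite !scale1r. Qed.

Lemma comp0l A B D (f : Mor A B) : (0 : Mor B D) \c f = 0.
Proof. by apply: (addrI (0 \c f)); rewrite -compDl !addr0. Qed.

Lemma comp0r A B D (g : Mor B D) : g \c (0 : Mor A B) = 0.
Proof. by apply: (addrI (g \c 0)); rewrite -compDr !addr0. Qed.

Lemma compZl A B D a (g : Mor B D) (f : Mor A B) : (a *: g) \c f = a *: (g \c f).
Proof. by have := comp_linearl f a g 0; rewrite comp0l !addr0. Qed.

Lemma compZr A B D a (g : Mor B D) (f : Mor A B) : g \c (a *: f) = a *: (g \c f).
Proof. by have := comp_linearr g a f 0; rewrite comp0r !addr0. Qed.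

Lemma compNl A B D (g : Mor B D) (f : Mor A B) : (- g) \c f = - (g \c f).
Proof. by rewrite -scaleN1r compZl scaleN1r. Qed.

Lemma compNr A B D (g : Mor B D) (f : Mor A B) : g \c (- f) = - (g \c f).
Proof. by rewrite -scaleN1r compZr scaleN1r. Qed.

Lemma pr1_in1K W A B (x : Mor W A) : pr1 A B \c (in1 A B \c x) = x.
Proof. by rewrite compA pr1_in1 comp1m. Qed.

Lemma pr2_in2K W A B (x : Mor W B) : pr2 A B \c (in2 A B \c x) = x.
Proof. by rewrite compA pr2_in2 comp1m. Qed.

Lemma pr1_in2K W A B (x : Mor W B) : pr1 A B \c (in2 A B \c x) = 0.
Proof. by rewrite compA pr1_in2 comp0l. Qed.

Lemma pr2_in1K W A B (x : Mor W A) : pr2 A B \c (in1 A B \c x) = 0.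
Proof. by rewrite compA pr2_in1 comp0l. Qed.

(** Rewriting with this rule distributes composition over sums, associates it
    to the right and evaluates projections on injections. *)
Definition compE := (compDl, compDr, compNl, compNr, comp0l, comp0r,
  comp1m, compm1, pr1_in1K, pr2_in2K, pr1_in2K, pr2_in1K,
  @pr1_in1 k C, @pr2_in2 k C, @pr1_in2 k C, @pr2_in1 k C,
  addr0, add0r, subr0, oppr0, fun A B D E h g f => esym (@compA k C A B D E h g f)).

Lemma bip_ext_in A B D (f g : Mor (A (+) B) D) :
  f \c in1 A B = g \c in1 A B -> f \c in2 A B = g \c in2 A B -> f = g.
Proof.
by move=> e1 e2; rewrite -[f]compm1 -[g]compm1 -in_pr !compDr !compA e1 e2.
Qed.

Lemma bip_ext_pr A B D (f g : Mor D (A (+) B)) :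
  pr1 A B \c f = pr1 A B \c g -> pr2 A B \c f = pr2 A B \c g -> f = g.
Proof.
by move=> e1 e2; rewrite -[f]comp1m -[g]comp1m -in_pr !compDl -!compA e1 e2.
Qed.

Lemma is_iso_id A : is_iso (idmor A).
Proof. by exists (idmor A); rewrite comp1m. Qed.

Lemma pr1_zob_iso A : is_iso (pr1 A (zob C)).
Proof.
exists (in1 A (zob C)); split; last by rewrite pr1_in1.
apply: bip_ext_pr; rewrite !compE //.
by rewrite [RHS]zob_terminal.
Qed.

(** * Weakly exact pairs *)

Definition weak_kernel A B D (f : Mor A B) (g : Mor B D) : Prop :=
  g \c f = 0 /\ forall W (h : Mor W B), g \c h = 0 -> exists h', h = f \c h'.

Definition weak_cokernel A B D (f : Mor A B) (g : Mor B D) : Prop :=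
  forall W (h : Mor B W), h \c f = 0 -> exists h', h = h' \c g.

(** Angles are exact in both variances, and both are used: weak kernels to lift
    maps, weak cokernels to extend them. *)
Definition exact2 A B D (f : Mor A B) (g : Mor B D) : Prop :=
  weak_kernel f g /\ weak_cokernel f g.

Lemma exact2_scaler A B D (f : Mor A B) (g : Mor B D) a :
  a != 0 -> exact2 f (a *: g) -> exact2 f g.
Proof.
move=> a0 [[z ker] coker]; split; first split.
- by move: z; rewrite compZl => /eqP; rewrite scaler_eq0 (negbTE a0) => /eqP.
- by move=> W h gh; apply: ker; rewrite compZl gh scaler0.
- move=> W h hf; have [h' ->] := coker W h hf; exists (a *: h').
  by rewrite compZl compZr.
Qed.

Lemma exact2_signr A B D (f : Mor A B) (g : Mor B D) n :
  exact2 f ((-1) ^+ n *: g) -> exact2 f g.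
Proof. by apply: exact2_scaler; rewrite signr_eq0. Qed.

Lemma exact2_iso A B B' D (t : Mor B B') (f : Mor A B) (g : Mor B' D) :
  is_iso t -> exact2 (t \c f) g -> exact2 f (g \c t).
Proof.
case=> s [st ts] [[z ker] coker]; split; first split.
- by rewrite -compA z.
- move=> W h; rewrite -compA => /ker[h' eh]; exists h'.
  by rewrite -[h]comp1m -st -compA eh !compA st comp1m.
- move=> W h hf; have [h' eh] : exists h', h \c s = h' \c g.
    by apply: coker; rewrite -compA (compA s) st comp1m.
  by exists h'; rewrite compA -eh -compA st compm1.
Qed.

Lemma exact2_isor A B D D' (f : Mor A B) (g : Mor B D) (z : Mor D D') :
  is_iso z -> exact2 f g -> exact2 f (z \c g).
Proof.
case=> z' [z'z zz'] [[gf ker] coker]; split; first split.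
- by rewrite -compA gf comp0r.
- move=> W h /(congr1 (compmor z')).
  by rewrite comp0r -compA compA z'z comp1m; apply: ker.
- move=> W h /coker [h' ->]; exists (h' \c z').
  by rewrite compA -(compA h') z'z compm1.
Qed.

Lemma exact2_square A B B' D D' (f : Mor A B) (g : Mor B D) (g' : Mor B' D')
    (z : Mor B B') (t : Mor D D') :
  is_iso z -> is_iso t -> g' \c z = t \c g -> exact2 f g -> exact2 (z \c f) g'.
Proof.
case=> z' [z'z zz'] it e ex.
have -> : g' = t \c g \c z' by rewrite -e -compA zz' compm1.
apply: exact2_iso; first by exists z.
by rewrite compA z'z comp1m; apply: exact2_isor.
Qed.

Lemma exact2_split_epi A A' B D (h : Mor A' A) (s : Mor A A') (f : Mor A B)
    (g : Mor B D) :
  h \c s = idmor A -> exact2 f g -> exact2 (f \c h) g.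
Proof.
move=> hs [[z ker] coker]; split; first split.
- by rewrite compA z comp0l.
- move=> W x /ker[x' ->]; exists (s \c x').
  by rewrite compA -(compA f) hs compm1.
- move=> W x; rewrite compA => /(congr1 (fun y => y \c s)).
  by rewrite -compA hs compm1 comp0l; apply: coker.
Qed.

Lemma exact2_in1 A B D W (f : Mor A B) (g : Mor B D) :
  exact2 f g -> exact2 (in1 B W \c f) (bmat g 0 0 (idmor W)).
Proof.
case=> [[z ker] coker]; split; first split.
- by rewrite /bmat !compE z !compE.
- move=> V h gh.
  have /ker[h' eh] : g \c (pr1 _ _ \c h) = 0.
    by move/(congr1 (fun x => pr1 _ _ \c x)): gh; rewrite /bmat !compE.
  have h2 : pr2 _ _ \c h = 0.
    by move/(congr1 (fun x => pr2 _ _ \c x)): gh; rewrite /bmat !compE.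
  by exists h'; apply: bip_ext_pr; rewrite ?h2 ?eh !compE.
- move=> V h; rewrite compA => /coker[h' eh].
  exists (h' \c pr1 _ _ + (h \c in2 _ _) \c pr2 _ _).
  by apply: bip_ext_in; rewrite /bmat ?eh !compE.
Qed.

Lemma exact2_bmat A B D W (u : Mor A B) (v : Mor B D) :
  exact2 u v -> exact2 (bmat u 0 0 (idmor W)) (v \c pr1 B W).
Proof.
case=> [[z ker] coker]; split; first split.
- by rewrite /bmat !compE compA z !compE.
- move=> V h; rewrite -compA => /ker [h' eh].
  exists (in1 _ _ \c h' + in2 _ _ \c (pr2 _ _ \c h)).
  by apply: bip_ext_pr; rewrite /bmat !compE.
- move=> V h hz.
  have h2 : h \c in2 B W = 0.
    by move/(congr1 (fun x => x \c in2 A W)): hz; rewrite /bmat !compE.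
  have /coker[h' eh] : (h \c in1 B W) \c u = 0.
    by move/(congr1 (fun x => x \c in1 A W)): hz; rewrite /bmat !compE.
  exists h'; apply: bip_ext_in; rewrite ?h2 ?eh; rewrite !compE //.
Qed.

(** The five lemma for A -> B -> X -> E -> F and A -> B -> Y -> E -> F. Diagram
    chases with maps W -> X and W -> Y in place of elements show that phi is a
    monomorphism and that it has a right inverse. *)
Lemma five_iso A B E F (p : Mor A B) X Y (g : Mor B X) (v : Mor X E)
    (u : Mor B Y) (w : Mor Y E) (q : Mor E F) (phi : Mor X Y) :
  weak_kernel p u -> weak_kernel v q -> weak_kernel u w -> weak_kernel g v ->
  g \c p = 0 -> q \c w = 0 ->
  phi \c g = u -> w \c phi = v -> is_iso phi.
Proof.
move=> [up keru] [qv kerv] [wu kerw] [vg kerg] gp qw eu ev.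
have mono W (x : Mor W X) : phi \c x = 0 -> x = 0.
  move=> x0; have /kerg[b eb] : v \c x = 0 by rewrite -ev -compA x0 comp0r.
  have /keru[a ea] : u \c b = 0 by rewrite -eu -compA -eb.
  by rewrite eb ea compA gp comp0l.
have [s es] := kerv _ w qw.
have /kerw[t et] : w \c (phi \c s - idmor Y) = 0.
  by rewrite !compE compA ev es subrr.
have [r pr] : exists r, phi \c r = idmor Y.
  exists (s - g \c t).
  by rewrite !compE compA eu -et opprB addrC subrK.
exists r; split=> //; apply/eqP; rewrite -subr_eq0; apply/eqP/mono.
by rewrite !compE compA pr comp1m subrr.
Qed.

(** * Chains *)

Lemma ccons_surj n A E (c : chain n.+1 A E) :
  exists B (f : Mor A B) (c' : chain n B E), c = ccons f c'.
Proof. by case: c => B [f c]; exists B, f, c. Qed.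

(** The first map of a chain, hmap below, and its target. A chain without inner
    objects is a single map, so a definition by chead would miss this case. *)
Definition hob n A E : chain n A E -> C :=
  match n return chain n A E -> C with
  | 0 => fun _ => E
  | m.+1 => fun c => cmid c
  end.

Definition hmap n A E : forall c : chain n A E, Mor A (hob c) :=
  match n return forall c : chain n A E, Mor A (hob c) with
  | 0 => fun f => f
  | m.+1 => fun c => chead c
  end.

Fixpoint cpre n A' A E (h : Mor A' A) : chain n A E -> chain n A' E :=
  match n return chain n A E -> chain n A' E with
  | 0 => fun f => (f : Mor A E) \c h
  | m.+1 => fun c => ccons (chead c \c h) (ctail c)
  end.

Lemma csnoc_cpre n A' A E T (h : Mor A' A) (c : chain n A E) (q : Mor E T) :
  csnoc (cpre h c) q = cpre h (csnoc c q).
Proof. by case: n c. Qed.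

Lemma cmap_csnoc n A E T (F : functor C) (c : chain n A E) (h : Mor E T) :
  cmap F (csnoc c h) = csnoc (cmap F c) (fmap F h).
Proof.
elim: n A c => [|n IH] A c //.
change (ccons (fmap F (chead c)) (cmap F (csnoc (ctail c) h)) =
        ccons (fmap F (chead c)) (csnoc (cmap F (ctail c)) (fmap F h))).
by rewrite IH.
Qed.

Fixpoint cmaps_id n A E : forall c : chain n A E, cmaps c c :=
  match n return forall c : chain n A E, cmaps c c with
  | 0 => fun _ => tt
  | m.+1 => fun c => (idmor (cmid c), cmaps_id (ctail c))
  end.

Lemma cmaps_id_commute n A E (c : chain n A E) :
  cmaps_commute (idmor A) (idmor E) (cmaps_id c).
Proof.
elim: n A c => [|n IH] A c /=; first by rewrite comp1m compm1.
by rewrite comp1m compm1.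
Qed.

Lemma cmaps_id_iso n A E (c : chain n A E) : cmaps_iso (cmaps_id c).
Proof. by elim: n A c => [|n IH] A c //=; split=> //; apply: is_iso_id. Qed.

Lemma commute_hmap n A E A' E' (c : chain n A E) (c' : chain n A' E') a e
    (phi : cmaps c c') :
  cmaps_commute a e phi -> exists b, b \c hmap c = hmap c' \c a.
Proof.
case: n c c' phi => [|n] c c' phi /=; first by move=> H; exists e.
by case=> H _; exists phi.1.
Qed.

Lemma commute_csnoc n A E A' E' T T' (c : chain n A E) (c' : chain n A' E')
    (s : Mor E T) (s' : Mor E' T') a t (phi : cmaps (csnoc c s) (csnoc c' s')) :
  cmaps_commute a t phi ->
  exists (e : Mor E E') (psi : cmaps c c'),
    cmaps_commute a e psi /\ t \c s = s' \c e.
Proof.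
elim: n A A' c c' a phi => [|n IH] A A' c c' a phi /=.
  by case=> H1 H2; exists phi.1, tt.
case=> H1 /IH [e [psi [H2 H3]]]; exists e.
by exists (phi.1, psi).
Qed.

Lemma commute_sym n A E A' E' (c : chain n A E) (c' : chain n A' E')
    (a : Mor A A') (a' : Mor A' A) (e : Mor E E') (e' : Mor E' E)
    (phi : cmaps c c') :
  a \c a' = idmor A' -> e' \c e = idmor E ->
  cmaps_commute a e phi -> cmaps_iso phi ->
  exists psi : cmaps c' c, cmaps_commute a' e' psi /\ cmaps_iso psi.
Proof.
move=> aa' ee'; elim: n A A' c c' a a' aa' phi => [|n IH] A A' c c' a a' aa' phi /=.
  move=> H _; exists tt; split=> //.
  rewrite -[c' in LHS]compm1 -aa' !compA -[_ \c c' \c a]compA -H.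
  by rewrite compA ee' comp1m.
case=> H1 H2 [[b [b1 b2]] H3].
have [psi [P1 P2]] := IH _ _ _ _ _ _ b2 _ H2 H3.
exists (b, psi); split; last by split=> //; exists phi.1.
split=> //=.
rewrite -[chead c' in LHS]compm1 -aa' !compA -[_ \c chead c' \c a]compA.
by rewrite -H1 compA b1 comp1m.
Qed.

Lemma commute_cpre n A A' E E' (c : chain n A E) (c' : chain n A' E') a e
    (phi : cmaps c c') B B' (h : Mor B A) (h' : Mor B' A') (b : Mor B B') :
  cmaps_commute a e phi ->
  hmap c' \c (h' \c b) = hmap c' \c (a \c h) ->
  exists psi : cmaps (cpre h c) (cpre h' c'), cmaps_commute b e psi.
Proof.
case: n c c' phi => [|n] c c' phi /=.
  by move=> H1 H2; exists tt; rewrite -compA H2 !compA H1.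
by case=> H1 H2 H3; exists phi; split=> //=; rewrite -compA H3 !compA H1.
Qed.

Lemma commute_cpre_r n A B E A' E' (c : chain n A E) (c' : chain n A' E')
    (h : Mor B A') (b : Mor A B) e (phi : cmaps c c') :
  cmaps_commute (h \c b) e phi -> cmaps_iso phi ->
  exists psi : cmaps c (cpre h c'), cmaps_commute b e psi /\ cmaps_iso psi.
Proof.
case: n c c' phi => [|n] c c' phi.
  by rewrite /= compA; exists tt.
by case=> H1 H2 H3; exists phi; split=> //; split=> //=; rewrite -compA.
Qed.

Lemma commute_cpost n A E A' E' T (c : chain n A E) (c' : chain n A' E') (s : Mor E' T)
    a e (phi : cmaps c c') :
  cmaps_commute a e phi ->
  exists psi : cmaps c (cpost c' s), cmaps_commute a (s \c e) psi.
Proof.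
elim: n A A' c c' a phi => [|n IH] A A' c c' a phi /=.
  by move=> H; exists tt; rewrite -compA H compA.
by case=> H1 /IH [psi H2]; exists (phi.1, psi).
Qed.

(** The zero objects added to the inner objects can be dropped; only the
    summands W and W' at the two ends remain. *)
Lemma csum_czero_iso n A E F W W' G (c : chain n A E) (h : Mor E F)
    (s : Mor (F (+) W') G) :
  exists phi : cmaps (cpost (csum (csnoc c h) (czero n.+1 W W')) s)
                     (csnoc c (s \c in1 F W' \c h)),
    cmaps_commute (pr1 A W) (idmor G) phi /\ cmaps_iso phi.
Proof.
elim: n A W c => [|n IH] A W c.
  exists (pr1 E (zob C), tt); split; last by split=> //; apply: pr1_zob_iso.
  by split; rewrite /= /bmat !compE.
have [phi [com iso]] := IH _ (zob C) (ctail c).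
exists (pr1 (cmid c) (zob C), phi); split.
  by split=> //=; rewrite /bmat !compE.
by split=> //; apply: pr1_zob_iso.
Qed.

(** * Exact chains *)

(** The map p stands before the chain, so that exactness at the first object of
    the chain is included. Exactness at its last object is expressed by adding
    one more map with csnoc. *)
Fixpoint pexact n A' A E (p : Mor A' A) : chain n A E -> Prop :=
  match n return chain n A E -> Prop with
  | 0 => fun f => exact2 p (f : Mor A E)
  | m.+1 => fun c => exact2 p (chead c) /\ pexact (chead c) (ctail c)
  end.

(** Exactness at one inner object, the one of index i+1. In a rotated angle this
    is exactness at the next object of the angle, which makes an induction on i
    possible. It is vacuous when i is out of range. *)
Fixpoint exact_at i n A E : chain n A E -> Prop :=
  match i, n return chain n A E -> Prop with
  | 0, m.+1 => fun c => exact2 (chead c) (hmap (ctail c))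
  | j.+1, m.+1 => fun c => exact_at j (ctail c)
  | _, 0 => fun _ => True
  end.

Lemma exact_at_csnoc i n A E T (c : chain n A E) (h : Mor E T) :
  exact_at i (csnoc c h) -> exact_at i c.
Proof.
elim: i n A c => [|i IH] [|n] A //= c; last exact: IH.
by case: n c => [|n].
Qed.

Lemma pexact_from_exact_at n A' A E (p : Mor A' A) (c : chain n A E) :
  (forall i, exact_at i (ccons p c)) -> pexact p c.
Proof.
elim: n A' A p c => [|n IH] A' A p c ex; first exact: (ex 0%N).
split; first exact: (ex 0%N).
apply: IH => i; have := ex i.+1.
by rewrite /=; case: c {ex} => B [g c].
Qed.

Lemma pexact_last n A' A E T (p : Mor A' A) (c : chain n A E) (q : Mor E T) :
  pexact p (csnoc c q) -> exists K (l : Mor K E), exact2 l q.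
Proof.
elim: n A' A p c => [|n IH] A' A p c /= [_]; first by exists A, c.
exact: IH.
Qed.

Lemma pexact_csnoc_head n A B E F (p : Mor A B) (c : chain n B E) (q : Mor E F) :
  pexact p (csnoc c q) -> exact2 p (hmap c).
Proof. by case: n c => [|n] c []. Qed.

Lemma pexact_csnoc_sign n A B E F (p : Mor A B) (c : chain n B E) (q : Mor E F) i :
  pexact p (csnoc c ((-1) ^+ i *: q)) -> pexact p (csnoc c q).
Proof.
elim: n A B p c => [|n IH] A B p c; last by case=> H1 H2; split=> //; apply: IH.
by case=> H1 H2; split=> //; apply: exact2_signr H2.
Qed.

Lemma pexact_cpost n A B E E' F F' (p : Mor A B) (c : chain n B E) (q : Mor E F)
    (q' : Mor E' F') (z : Mor E E') (t : Mor F F') :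
  is_iso z -> is_iso t -> q' \c z = t \c q -> pexact p (csnoc c q) ->
  pexact p (csnoc (cpost c z) q').
Proof.
move=> iz it e; elim: n A B p c => [|n IH] A B p c; last first.
  by case=> ex1 ex2; split=> //; apply: IH.
case=> ex1 ex2; split; first exact: exact2_isor.
exact: exact2_square iz it e ex2.
Qed.

Lemma pexact_split_epi n A A' B E (h : Mor A' A) (s : Mor A A') (f : Mor A B)
    (c : chain n B E) :
  h \c s = idmor A -> pexact f c -> pexact (f \c h) c.
Proof.
move=> hs; case: n c => [|n] c; first exact: exact2_split_epi hs.
by case=> ex1 ex2; split=> //; apply: exact2_split_epi hs ex1.
Qed.

Lemma pexact_bmat n A B W E (u : Mor A B) (c : chain n B E) :
  pexact u c -> pexact (bmat u 0 0 (idmor W)) (cpre (pr1 B W) c).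
Proof.
case: n c => [|n] c; first exact: exact2_bmat.
case=> ex1 ex2; split; first exact: exact2_bmat.
by apply: (pexact_split_epi (s := in1 B W)) ex2; rewrite pr1_in1.
Qed.

(** The vertical maps are found from right to left. Each one is a lift along a
    map v of c of a composite that starts with a map of cx; by commutativity of
    the next square, the map that follows v kills this composite, because cx is
    a complex. *)
Lemma lift_chain n X' X E' F' B' B E F (g : Mor X' X) (cx : chain n X E')
    (q' : Mor E' F') (u : Mor B' B) (c : chain n B E) (q : Mor E F)
    (e : Mor E' E) (r : Mor F' F) :
  pexact g (csnoc cx q') -> pexact u (csnoc c q) -> q \c e = r \c q' ->
  exists (d0 : Mor X B) (delta : cmaps cx c), cmaps_commute d0 e delta.
Proof.
elim: n X' X B' B g cx u c => [|n IH] X' X B' B g cx u c exx exc qe.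
  case: exx => _ /= [[z _] _]; case: exc => _ /= [[_ ker] _].
  have [|d0 e0] := ker _ (e \c (cx : Mor _ _)).
    by rewrite compA qe -compA z comp0r.
  by exists d0, tt.
case: exx => _ exx; case: exc => _ exc.
have [d1 [delta com]] := IH _ _ _ _ _ _ _ _ exx exc qe.
have [b eb] := commute_hmap com.
have [[z _] _] := pexact_csnoc_head exx.
have [[_ ker] _] := pexact_csnoc_head exc.
have [|d0 e0] := ker _ (d1 \c chead cx).
  by rewrite compA -eb -compA z comp0r.
by exists d0, (d1, delta).
Qed.

(** * Weak isomorphisms of exact chains *)

(** Adds the contractible summand W = W at the inner objects of indices i+1 and
    i+2, if there are so many; otherwise the chain is left unchanged. *)
Fixpoint addtriv i W n A E : chain n A E -> chain n A E :=
  match i, n return chain n A E -> chain n A E with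
  | 0, m.+2 => fun c =>
      ccons (in1 (cmid c) W \c chead c)
        (ccons (bmat (chead (ctail c)) 0 0 (idmor W))
           (cpre (pr1 _ W) (ctail (ctail c))))
  | j.+1, m.+1 => fun c => ccons (chead c) (addtriv j W (ctail c))
  | _, _ => fun c => c
  end.

(** The first alternative covers the indices out of range, where an additional
    map could bring i into the range. *)
Lemma csnoc_addtriv i W n A E (c : chain n A E) :
  addtriv i W c = c \/
  forall T (h : Mor E T), csnoc (addtriv i W c) h = addtriv i W (csnoc c h).
Proof.
elim: i n A c => [|i IH] [|n] A c /=; try by left.
  case: n c => [|n] c /=; first by left.
  by right=> T h; rewrite csnoc_cpre.
case: (IH _ _ (ctail c)) => [->|H]; first by left; case: c => B [].
by right=> T h; rewrite -H.
Qed.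

(** The invariance is required of a property, rather than expressed by an
    equivalence relation between chains, because it then passes to the tails of
    chains with a fixed first map, which allows inductions on the length. *)
Definition homotopy_invariant n A E (P : chain n A E -> Prop) : Prop :=
  (forall c c' (phi : cmaps c c'),
     cmaps_commute (idmor A) (idmor E) phi -> cmaps_iso phi -> P c -> P c')
  /\ forall i W c, P (addtriv i W c) <-> P c.

Lemma homotopy_invariant_ccons n A B E (f : Mor A B) (P : chain n.+1 A E -> Prop) :
  homotopy_invariant P -> homotopy_invariant (fun c => P (ccons f c)).
Proof.
case=> Piso Ptriv; split=> [c c' phi com iso|i W c]; last first.
  exact: (Ptriv i.+1 W (ccons f c)).
apply: (Piso (ccons f c) (ccons f c') (idmor B, phi)); split=> //=.
- by rewrite comp1m compm1.
- exact: is_iso_id.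
Qed.

(** The automorphism (x, y) |-> (x - a (y + f x), y + f x) of X (+) Y, a product
    of two elementary matrices, followed by the exchange of the summands. *)
Definition shear X Y (f : Mor X Y) (a : Mor Y X) : Mor (X (+) Y) (Y (+) X) :=
  in1 Y X \c (pr2 X Y + f \c pr1 X Y)
  + in2 Y X \c (pr1 X Y - a \c (pr2 X Y + f \c pr1 X Y)).

Lemma shear_iso X Y (f : Mor X Y) (a : Mor Y X) : is_iso (shear f a).
Proof.
pose x : Mor (Y (+) X) X := pr2 _ _ + a \c pr1 _ _.
exists (in1 _ _ \c x + in2 _ _ \c (pr1 _ _ - f \c x)).
split; apply: bip_ext_pr; rewrite /shear /x !compE.
- by rewrite addrC subrK.
- by rewrite opprB addrA subrK addrK.
- by rewrite addrC subrK.
- by rewrite opprB addrA subrK addrK.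
Qed.

Lemma shear_in1 B X Y (g : Mor B X) (u : Mor B Y) (f : Mor X Y) (a : Mor Y X) :
  f \c g = u -> a \c u = g -> shear f a \c (in1 X Y \c g) = in1 Y X \c u.
Proof.
move=> fg au; apply: bip_ext_pr; rewrite /shear !compE ?fg //.
by rewrite au subrr.
Qed.

(** The first square whose vertical map f1 may fail to be invertible is pushed
    one step to the right. Add Y1 = Y1 to the source and X1 = X1 to the target:
    then both chains start with B -> X1 (+) Y1, up to the isomorphism shear. To
    extend the morphism to X2 (+) Y1 -> Y2 (+) X1, note that 1 - a f1 vanishes
    on the image of g because a u = g, so that it factors through g1. *)
Lemma weak_iso_step n B E F X1 X2 Y1 Y2 (q : Mor E F)
    (g : Mor B X1) (g1 : Mor X1 X2) (c : chain n X2 E)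
    (u : Mor B Y1) (u1 : Mor Y1 Y2) (c' : chain n Y2 E)
    (f1 : Mor X1 Y1) (f2 : Mor X2 Y2) (phi : cmaps c c') :
  exact2 g g1 -> pexact g1 (csnoc c q) ->
  exact2 u u1 -> pexact u1 (csnoc c' q) ->
  f1 \c g = u -> f2 \c g1 = u1 \c f1 -> cmaps_commute f2 (idmor E) phi ->
  (exists a : Mor Y1 X1, a \c u = g) ->
  exists (M1 : Mor (X1 (+) Y1) (X2 (+) Y1)) (M2 : Mor (X1 (+) Y1) (Y2 (+) X1))
    (psi : cmaps (ccons M1 (cpre (pr1 X2 Y1) c)) (ccons M2 (cpre (pr1 Y2 X1) c'))),
  [/\ pexact (in1 X1 Y1 \c g) (csnoc (ccons M1 (cpre (pr1 X2 Y1) c)) q),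
      pexact (in1 X1 Y1 \c g) (csnoc (ccons M2 (cpre (pr1 Y2 X1) c')) q),
      cmaps_commute (idmor _) (idmor E) psi,
      M1 = bmat g1 0 0 (idmor Y1)
    & exists th, [/\ is_iso th, th \c (in1 X1 Y1 \c g) = in1 Y1 X1 \c u
                   & M2 = bmat u1 0 0 (idmor X1) \c th]].
Proof.
move=> exg exc exu exc' H1 H2 H3 [a ea].
have [r er] : exists r : Mor X2 X1, idmor X1 - a \c f1 = r \c g1.
  by apply: (proj2 exg); rewrite !compE H1 ea subrr.
pose M2 := bmat u1 0 0 (idmor X1).
pose th := shear f1 a.
have th_iso : is_iso th by apply: shear_iso.
have thin : th \c (in1 X1 Y1 \c g) = in1 Y1 X1 \c u by apply: shear_in1.
(* The second row (r, -a) is forced by the second component of shear. *)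
pose chi := bmat f2 u1 r (- a).
have chiE : chi \c bmat g1 0 0 (idmor Y1) = M2 \c th.
  apply: bip_ext_in; apply: bip_ext_pr; rewrite /chi /M2 /th /bmat /shear !compE //.
have [psi com] : exists psi : cmaps (cpre (pr1 X2 Y1) c) (cpre (pr1 Y2 X1) c'),
    cmaps_commute chi (idmor E) psi.
  apply: commute_cpre H3 _.
  have [[z _] _] := pexact_csnoc_head exc'.
  rewrite /chi /bmat !compE.
  by rewrite (compA (hmap c') u1) z !compE.
exists (bmat g1 0 0 (idmor Y1)), (M2 \c th), (chi, psi); split=> //.
- split; first exact: exact2_in1.
  by have := pexact_bmat Y1 exc; rewrite -csnoc_cpre.
- split; first by apply: exact2_iso => //; rewrite thin; apply: exact2_in1.
  case: th_iso => th' [_ thK].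
  have := pexact_split_epi thK (pexact_bmat X1 exc').
  by rewrite -csnoc_cpre.
- by split; rewrite ?compm1.
- by exists th; split.
Qed.

(** A morphism of exact sequences that is the identity at two consecutive
    objects is a homotopy equivalence. The non-invertible part is moved to the
    right until a single inner object is left, where the five lemma applies. *)
Theorem weak_iso_invariant n B E (c c' : chain n.+1 B E) A F (p : Mor A B)
    (q : Mor E F) (phi : cmaps c c') :
  pexact p (csnoc c q) -> pexact p (csnoc c' q) ->
  cmaps_commute (idmor B) (idmor E) phi ->
  forall P, homotopy_invariant P -> P c -> P c'.
Proof.
elim: n A B c c' p phi => [|n IH] A B.
  move=> [X [g v]] [Y [u w]] p phi.
  rewrite /= /chead /ctail /= => -[exg [exv exq]] [exu [exw exq']] [H1 H2] P [Piso _].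
  apply: (Piso _ _ phi) => //=; split=> //.
  apply: (five_iso (proj1 exu) (proj1 exq) (proj1 exw) (proj1 exv)).
  - by case: exg => -[].
  - by case: exq' => -[].
  - by rewrite H1 compm1.
  - by rewrite -H2 comp1m.
move=> [X1 [g [X2 [g1 c]]]] [Y1 [u [Y2 [u1 c']]]] p [f1 [f2 f3]].
move=> [exg [exg1 exc]] [exu [exu1 exc']] [H1 [H2 H3]] P Pinv Pc.
move: H1; rewrite compm1 => H1.
have ea : exists a : Mor Y1 X1, a \c u = g.
  have [|a ->] := proj2 exu _ g; last by exists a.
  by case: exg => -[].
have [M1 [M2 [psi [ex1 ex2 com eM1 [th [th_iso thin eM2]]]]]] :=
  weak_iso_step (c := c) (c' := c') (f1 := f1) (f2 := f2) (phi := f3)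
    exg1 exc exu1 exc' H1 H2 H3 ea.
have P1 : P (ccons (in1 X1 Y1 \c g) (ccons M1 (cpre (pr1 X2 Y1) c))).
  by rewrite eM1; apply/(proj2 Pinv 0%N Y1 (ccons g (ccons g1 c))).
have Pinv' := homotopy_invariant_ccons (in1 X1 Y1 \c g) Pinv.
have P2 := IH _ _ _ _ _ _ ex1 ex2 com _ Pinv' P1.
apply/(proj2 Pinv 0%N X1 (ccons u (ccons u1 c'))).
pose t := cpre (pr1 Y2 X1) c'.
have [_ com'] := cmaps_id_commute (ccons (bmat u1 0 0 (idmor X1)) t).
apply: (proj1 Pinv (ccons (in1 X1 Y1 \c g) (ccons M2 t))
  (ccons (in1 Y1 X1 \c u) (ccons (bmat u1 0 0 (idmor X1)) t))
  (th, (idmor (Y2 (+) X1), cmaps_id t)) _ _ P2).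
- split; first by rewrite compm1.
  by split=> //; rewrite [LHS]comp1m eM2.
- by do 2![split=> //]; [apply: is_iso_id | apply: cmaps_id_iso].
Qed.

End Categories.

(** * Suspension *)

Section Suspension.
Variables (k : fieldType) (C : addcat k) (Sig : automorphism C).
Implicit Types A B : C.

Lemma fmap0 (F : functor C) A B : linear_functor F -> fmap F (0 : Mor A B) = 0.
Proof. by move=> /(_ A B (-1) 0 0); rewrite !scaleN1r !addNr. Qed.

Lemma fmapD (F : functor C) A B (f g : Mor A B) :
  linear_functor F -> fmap F (f + g) = fmap F f + fmap F g.
Proof. by move=> lF; rewrite -[f]scale1r lF !scale1r. Qed.

(** An equality of packed arrows yields an equality of maps only up to transport
    along loops A = A and B = B; these are trivial by uniqueness of identity
    proofs. *)
Lemma arrow_inj A B (f g : Mor A B) : Arrow f = Arrow g -> f = g.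
Proof.
move=> e.
have {}e : existT (fun A => {B & Mor A B}) A (existT _ B f) =
           existT (fun A => {B & Mor A B}) A (existT _ B g).
  exact: (congr1 (fun x : arrow C => existT (fun A => {B & Mor A B}) (src x)
    (existT _ (tgt x) (arr x))) e).
by have := inj_pair2 _ _ _ _ _ (inj_pair2 _ _ _ _ _ e).
Qed.

Lemma sig_faithful A B (f g : Mor A B) : fmap Sig f = fmap Sig g -> f = g.
Proof.
move=> e; apply: arrow_inj; apply: (can_inj (autK Sig)).
by rewrite /amap /= e.
Qed.

Lemma sig_surj A : exists A', A = Sig A'.
Proof.
exists (aut_inv Sig A).
by have /(congr1 (@src k C)) := autVK Sig (Arrow (idmor A)).
Qed.

Lemma sig_full A B (h : Mor (Sig A) (Sig B)) : exists h', h = fmap Sig h'.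
Proof.
have := autVK Sig (Arrow h).
set x := amap (aut_inv Sig) (Arrow h).
have sx : src x = A.
  by have /(congr1 (@src k C)) := autK Sig (Arrow (idmor A)).
have tx : tgt x = B.
  by have /(congr1 (@src k C)) := autK Sig (Arrow (idmor B)).
case: x sx tx => /= A' B' f eA eB; subst A' B'.
by move=> e; exists f; apply: arrow_inj.
Qed.

End Suspension.

(** * Exactness of angles *)

Section Exactness.
Variables (k : fieldType) (C : addcat k) (d : nat) (Sig : automorphism C).
Variables (Theta : sigma_seq d.+1 Sig -> Prop) (C_ang : angulated Theta).
Implicit Types A B D W : C.

Lemma angle_comp A0 A1 A2 (f0 : Mor A0 A1) (f1 : Mor A1 A2) (c : chain d A2 (Sig A0)) :
  Theta (SigmaSeq (ccons f0 (ccons f1 c))) -> f1 \c f0 = 0.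
Proof.
move=> X; have [phi [com _]] :=
  N3 (c := czero d.+1 A0 (Sig A0)) (c' := ccons f1 c) C_ang (N1_triv C_ang A0) X
     (phi0 := idmor A0) (phi1 := f0) (erefl _).
by rewrite -com comp0r.
Qed.

(** A map h : W -> A1 with f1 h = 0 is the start of a morphism from the rotation
    W -> 0 -> ... -> Sigma W -> Sigma W of the trivial angle to the rotation of
    the given one, and the last map of this morphism is the suspension of a
    lift. *)
Lemma angle_weak_kernel A0 A1 A2 (f0 : Mor A0 A1) (f1 : Mor A1 A2)
    (c : chain d A2 (Sig A0)) :
  Theta (SigmaSeq (ccons f0 (ccons f1 c))) -> weak_kernel f0 f1.
Proof.
move=> X; split; first exact: angle_comp X.
move=> W h f1h.
have [|phi com] := N3 (g0 := f1) (c' := csnoc c ((-1) ^+ d.+1 *: fmap Sig f0))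
  C_ang (proj1 (N2 C_ang _) (N1_triv C_ang W)) (proj1 (N2 C_ang _) X)
  (phi0 := h) (phi1 := 0).
  by rewrite comp0l f1h.
have [e [psi [_]]] := commute_csnoc com.
rewrite compZl compZr => /(scalerI _) H.
have {}H : fmap Sig h = fmap Sig f0 \c e.
  rewrite -H ?signr_eq0 //.
  by rewrite /chead /= fmap1 compm1.
have [h' eh'] := sig_full e.
by exists h'; apply: (@sig_faithful _ _ Sig); rewrite H eh' fmapM.
Qed.

Lemma seq_isomorphic_sym (X Y : sigma_seq d.+1 Sig) :
  seq_isomorphic X Y -> seq_isomorphic Y X.
Proof.
case=> a [phi [com [b [ba ab]] iso]].
have sba : fmap Sig b \c fmap Sig a = idmor _ by rewrite -fmapM ba fmap1.
have [psi [com' iso']] := commute_sym ab sba com iso.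
by exists b, psi; split=> //; exists a.
Qed.

(** The rotation turns the summand W = W at the first two inner objects into one
    at the first two objects, where the trivial angle on W has it. *)
Lemma rotation_addtriv_iso A B D W (f : Mor A B) (g : Mor B D) (c : chain d D (Sig A)) :
  seq_isomorphic
    (seq_sum (left_rotation (SigmaSeq (d := d.+1) (ccons f (ccons g c))))
             (seq_triv d.+1 Sig W))
    (left_rotation (SigmaSeq (d := d.+1) (addtriv 0 W (ccons f (ccons g c))))).
Proof.
pose h := (-1) ^+ d.+1 *: fmap Sig f.
have [phi [com iso]] := csum_czero_iso W c h (sig_bip Sig B W).
have eh : sig_bip Sig B W \c in1 _ _ \c h = (-1) ^+ d.+1 *: fmap Sig (in1 B W \c f).
  by rewrite /sig_bip !compE compZr fmapM.
have [psi [com' iso']] : exists psi :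
    cmaps (cpost (csum (csnoc c h) (czero d.+1 W (Sig W))) (sig_bip Sig B W))
          (csnoc (cpre (pr1 D W) c) ((-1) ^+ d.+1 *: fmap Sig (in1 B W \c f))),
    cmaps_commute (idmor (D (+) W)) (idmor _) psi /\ cmaps_iso psi.
  rewrite -eh csnoc_cpre; apply: (commute_cpre_r (phi := phi)) => //.
  by rewrite compm1.
exists (idmor _), (idmor _, psi); split.
- by rewrite fmap1; split=> //; rewrite compm1 comp1m.
- exact: is_iso_id.
- by split=> //; apply: is_iso_id.
Qed.

(** Rotations reduce the position of the summand to the first one. There N1
    applies: angles are stable under sums with the trivial angle and under
    direct summands. *)
Lemma addtriv_angle i W A (c : chain d.+2 A (Sig A)) :
  Theta (SigmaSeq (addtriv i W c)) <-> Theta (SigmaSeq c).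
Proof.
elim: i A c => [|i IH] A c0; have [B [f [c ->]]] := ccons_surj c0.
  have [D [g [{}c ->]]] := ccons_surj c.
  have iso := rotation_addtriv_iso W f g c.
  split=> H; apply: (proj2 (N2 C_ang _)); have {}H := proj1 (N2 C_ang _) H.
  - have {}H := N1_iso C_ang (seq_isomorphic_sym iso) H.
    exact: (proj1 (N1_summand C_ang H)).
  - apply: (N1_iso C_ang iso).
    by have := N1_sum C_ang H (N1_triv C_ang W).
case: (csnoc_addtriv i W c) => [e|e].
  by rewrite /= /chead /ctail /= e.
have rotE : left_rotation (SigmaSeq (d := d.+1) (addtriv i.+1 W (ccons f c))) =
    SigmaSeq (addtriv i W (csnoc c ((-1) ^+ d.+1 *: fmap Sig f))).
  by rewrite -e.
split=> H; apply: (proj2 (N2 C_ang _)); have {}H := proj1 (N2 C_ang _) H.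
- by rewrite rotE in H; exact: (proj1 (IH _ _) H).
- by rewrite rotE; exact: (proj2 (IH _ _) H).
Qed.

Lemma angle_invariant A B (f : Mor A B) :
  homotopy_invariant (fun c : chain d.+1 B (Sig A) => Theta (SigmaSeq (ccons f c))).
Proof.
apply: (homotopy_invariant_ccons f
  (P := fun c : chain d.+2 A (Sig A) => Theta (SigmaSeq c))).
split=> [c c' phi com iso|i W c]; last exact: addtriv_angle.
apply: (N1_iso C_ang); exists (idmor A), phi; split=> //; last exact: is_iso_id.
by rewrite fmap1.
Qed.

Lemma angle_exact2 A0 A1 A2 (f0 : Mor A0 A1) (f1 : Mor A1 A2)
    (c : chain d A2 (Sig A0)) :
  Theta (SigmaSeq (ccons f0 (ccons f1 c))) -> exact2 f0 f1.
Proof.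
move=> X; split; first exact: angle_weak_kernel X.
move=> W h hf.
(* The angle 0 -> W = W -> 0 -> ... *)
have T := proj2 (addtriv_angle 0 W _) (N1_triv C_ang (zob C)).
have [|phi [com _]] := N3 C_ang X T (phi0 := 0) (phi1 := in2 (zob C) W \c h).
  by rewrite comp0r -compA hf comp0r.
exists (pr2 _ _ \c phi.1).
by rewrite -compA com /= /bmat !compE.
Qed.

Lemma angle_exact_at i A (c : chain d.+2 A (Sig A)) :
  Theta (SigmaSeq c) -> exact_at i c.
Proof.
elim: i A c => [|i IH] A c0; have [B [f [c ->]]] := ccons_surj c0 => X.
  by have [D [g [c' e]]] := ccons_surj c; subst c; apply: angle_exact2 X.
by apply: exact_at_csnoc (IH _ _ (proj1 (N2 C_ang _) X)).
Qed.

Theorem angle_pexact A B (f : Mor A B) (c : chain d.+1 B (Sig A)) :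
  Theta (SigmaSeq (ccons f c)) -> pexact f (csnoc c (fmap Sig f)).
Proof.
move=> X; apply: (pexact_csnoc_sign (i := d.+1)); apply: pexact_from_exact_at => -[|i].
  have := angle_exact_at 0 X; by have [D [g [{X}c ->]]] := ccons_surj c.
exact: angle_exact_at (proj1 (N2 C_ang _) X).
Qed.

Lemma sig_exact2 A B D (f : Mor A B) (g : Mor B D) :
  exact2 (fmap Sig f) (fmap Sig g) -> exact2 f g.
Proof.
have sig0 X Y : fmap Sig (0 : Mor X Y) = 0 by apply/fmap0/aut_linear.
case=> [[z ker] coker]; split; first split.
- by apply: (@sig_faithful _ _ Sig); rewrite fmapM z sig0.
- move=> W h gh; have [|h' eh] := ker _ (fmap Sig h); first by rewrite -fmapM gh sig0.
  have [h'' e] := sig_full h'; exists h''.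
  by apply: (@sig_faithful _ _ Sig); rewrite fmapM eh e.
- move=> W h hf; have [|h' eh] := coker _ (fmap Sig h); first by rewrite -fmapM hf sig0.
  have [h'' e] := sig_full h'; exists h''.
  by apply: (@sig_faithful _ _ Sig); rewrite fmapM eh e.
Qed.

(** In an angle that starts with g, the last map is a weak kernel of Sigma g. *)
Lemma exists_weak_kernel B D (g : Mor B D) : exists A (f : Mor A B), exact2 f g.
Proof.
have [c X] := N1_first C_ang g.
have [K [l ex]] := pexact_last (angle_pexact X).
have [A eA] := sig_surj Sig K; subst K.
have [f ef] := sig_full l; subst l.
by exists A, f; apply: sig_exact2.
Qed.

(** A map h with h f = 0 vanishes on any other weak kernel of g as well, since
    that one factors through f; and there is one with weak cokernel g. *)
Lemma weak_kernel_exact2 A B D (f : Mor A B) (g : Mor B D) :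
  weak_kernel f g -> exact2 f g.
Proof.
move=> kf; split=> // W h hf.
have [K [l [[z _] coker]]] := exists_weak_kernel g.
by apply: coker; have [l' ->] := proj2 kf _ l z; rewrite compA hf comp0l.
Qed.

End Exactness.

(** * Linear algebra *)

Section LinearAlgebra.
Variables (k : fieldType).
Implicit Types V W : vectType k.

Lemma linear_lfun V W (f : V -> W) :
  linear f -> exists F : 'Hom(V, W), forall v, F v = f v.
Proof.
move=> lf.
pose fL := GRing.isLinear.Build k V W *:%R f lf.
pose g : {linear V -> W} := HB.pack f fL.
by exists (linfun g) => v; rewrite lfunE.
Qed.

Lemma bilinear_lfun V W (f : V -> W -> k^o) :
  (forall v, linear (f v)) -> (forall w, linear (f^~ w)) ->
  exists F : 'Hom(V, 'Hom(W, k^o)), forall v w, F v w = f v w.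
Proof.
move=> lfr lfl.
pose g v : {linear W -> k^o} :=
  HB.pack (f v) (GRing.isLinear.Build k W k^o *:%R (f v) (lfr v)).
have gE v w : linfun (g v) w = f v w by rewrite lfunE.
have [|F eF] := @linear_lfun _ _ (fun v => linfun (g v)).
  by move=> a u v; apply/lfunP => w; rewrite add_lfunE scale_lfunE !gE lfl.
by exists F => v w; rewrite eF gE.
Qed.

Lemma factor_through V W (f : 'Hom(V, W)) (l : 'Hom(V, k^o)) :
  (forall v, f v = 0 -> l v = 0) -> exists m : 'Hom(W, k^o), forall v, m (f v) = l v.
Proof.
move=> kf; exists (l \o f^-1)%VF => v; rewrite comp_lfunE.
apply/eqP; rewrite -subr_eq0 -linearB /=; apply/eqP/kf.
by rewrite linearB /= limg_lfunVK ?subrr // memv_img // memvf.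
Qed.

Lemma functional_separates V (v : V) :
  (forall l : 'Hom(V, k^o), l v = 0) -> v = 0.
Proof.
move=> lv0; apply/eqP; case: eqP => // /eqP v0.
have := coord_vbasis (memvf v).
rewrite big1 => [v00|i _]; first by rewrite v00 eqxx in v0.
have [l el] := linear_lfun (f := coord (vbasis fullv) i : V -> k^o)
  (fun a u w => linearP _ a u w).
by rewrite -el lv0 scale0r.
Qed.

Lemma inj_lfun_surj V W (f : 'Hom(V, W)) :
  dim V = dim W -> injective f -> forall w, exists v, f v = w.
Proof.
move=> dVW /lker0P kf w.
have : (w \in limg f)%VS.
  suff -> : limg f = fullv by rewrite memvf.
  apply/eqP; rewrite eqEdim subvf limg_dim_eq; last by rewrite (eqP kf) capv0.
  by rewrite !dimvf dVW leqnn.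
by case/memv_imgP=> v _ ->; exists v.
Qed.

Lemma dim_bij V W (f : {linear V -> W}) : bijective f -> dim V = dim W.
Proof.
case=> g fK gK; pose F := linfun f.
have kF : lker F == 0%VS.
  by apply/lker0P => u v; rewrite !lfunE /= => /(can_inj fK).
have := limg_dim_eq (f := F) (U := fullv); rewrite (eqP kF) capv0 => /(_ erefl).
have -> : limg F = fullv.
  apply/eqP; rewrite eqEsubv subvf; apply/subvP => w _.
  have -> : w = F (g w) by rewrite lfunE /= gK.
  by rewrite memv_img ?memvf.
by rewrite !dimvf.
Qed.

End LinearAlgebra.

(** * Serre duality *)

Section Serre.
Variables (k : fieldType) (C : addcat k) (S : right_serre C).
Implicit Types A B D E F G W X Z : C.

Definition tr A (h : Mor A (S A)) : k := eta S A A (idmor A) h.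

Lemma etaE A B (b : Mor A B) (h : Mor B (S A)) : eta S A B b h = tr (h \c b).
Proof. by rewrite /tr -eta_naturalr compm1. Qed.

Lemma trC A B (f : Mor A B) (h : Mor B (S A)) : tr (fmap S f \c h) = tr (h \c f).
Proof. by rewrite -[RHS]etaE -[f in RHS]comp1m eta_naturall. Qed.

Lemma tr_linear A : linear (@tr A : _ -> k^o).
Proof. by move=> a u v; rewrite /tr linearP. Qed.

Lemma trZ A a (h : Mor A (S A)) : tr (a *: h) = a * tr h.
Proof. by rewrite /tr linearZ. Qed.

Lemma trB A (h h' : Mor A (S A)) : tr (h - h') = tr h - tr h'.
Proof. by rewrite /tr linearB. Qed.

Lemma tr0 A : tr (0 : Mor A (S A)) = 0.
Proof. by rewrite /tr linear0. Qed.

Lemma tr_nondegenerate A W (h : Mor W (S A)) :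
  (forall b : Mor A W, tr (h \c b) = 0) -> h = 0.
Proof.
move=> h0; apply: functional_separates => l.
by have [g _ gK] := eta_bij S A W; rewrite -(gK l) etaE h0.
Qed.

Lemma tr_ext A W (h h' : Mor W (S A)) :
  (forall b : Mor A W, tr (h \c b) = tr (h' \c b)) -> h = h'.
Proof.
move=> e; apply/eqP; rewrite -subr_eq0; apply/eqP/tr_nondegenerate => b.
by rewrite compDl compNl trB e subrr.
Qed.

(** The duality eta represents functionals on Hom(W, S A); since the Hom spaces
    have finite dimension, the pairing is perfect on the other side too. *)
Lemma tr_represents A W (l : 'Hom(Mor A W, k^o)) :
  exists h : Mor W (S A), forall b, tr (h \c b) = l b.
Proof.
have [||F eF] := bilinear_lfun
  (f := fun (h : Mor W (S A)) (b : Mor A W) => tr (h \c b)).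
- by move=> h a b b'; rewrite compDr compZr tr_linear.
- by move=> b a h h'; rewrite compDl compZl tr_linear.
have dual_dim (V : vectType k) : dim 'Hom(V, k^o) = dim V by rewrite /dim /= muln1.
have [||h eh] := inj_lfun_surj (f := F) _ _ l.
- by rewrite dual_dim (dim_bij (eta_bij S A W)) dual_dim.
- move=> h h' e; apply: tr_ext => b.
  by rewrite -!eF e.
- by exists h => b; rewrite -eh eF.
Qed.

(** If S g kills h : W -> S B, then the functional b |-> tr (h b) on Hom(B, W)
    vanishes on the maps that factor through g, that is on the kernel of
    b |-> b f. So it comes from a functional on Hom(A, W), which represents a
    lift of h. *)
Lemma serre_weak_kernel A B D (f : Mor A B) (g : Mor B D) :
  exact2 f g -> weak_kernel (fmap S f) (fmap S g).
Proof.
case=> [[z _] coker]; split.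
  by rewrite -fmapM z; apply/fmap0/serre_linear.
move=> W h gh.
have [F eF] := linear_lfun (comp_linearl (D := W) f).
have [|l el] := linear_lfun (f := fun b : Mor B W => tr (h \c b) : k^o).
  by move=> a u v; rewrite compDr compZr tr_linear.
have [|m em] := factor_through (f := F) (l := l).
  move=> b; rewrite eF el => /coker [b' ->].
  by rewrite compA -trC compA gh comp0l tr0.
have [h' eh] := tr_represents m; exists h'.
apply: tr_ext => b.
by rewrite -compA trC -compA eh -eF em el.
Qed.

(** The functional b |-> tr (d2 b) on Hom(A2, X2) is prescribed on the maps g1 x
    and on the maps y f2; the hypothesis says that the two prescriptions agree
    where they overlap. *)
Lemma serre_extension A1 A2 A3 X1 X2 X3 (f1 : Mor A1 A2) (f2 : Mor A2 A3)
    (g1 : Mor X1 X2) (g2 : Mor X2 X3) (d1 : Mor X1 (S A1)) (d3 : Mor X3 (S A3)) :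
  (forall (x : Mor A2 X1) (y : Mor A3 X2), y \c f2 = g1 \c x ->
     tr (d1 \c x \c f1) = tr (d3 \c g2 \c y)) ->
  exists d2 : Mor X2 (S A2),
    d2 \c g1 = fmap S f1 \c d1 /\ fmap S f2 \c d2 = d3 \c g2.
Proof.
move=> H.
have [|F eF] := linear_lfun (V := (Mor A2 X1 * Mor A3 X2)%type)
    (f := fun p => g1 \c p.1 - p.2 \c f2).
  move=> a u v; rewrite compDr compDl compZl compZr.
  by rewrite opprD addrACA scalerBr.
have [|l el] := linear_lfun (V := (Mor A2 X1 * Mor A3 X2)%type)
    (f := fun p => tr (d1 \c p.1 \c f1) - tr (d3 \c g2 \c p.2) : k^o).
  move=> a u v; rewrite !compDr compDl !compZr compZl !tr_linear.
  by rewrite opprD addrACA scalerBr.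
have [|m em] := factor_through (f := F) (l := l).
  case=> x y; rewrite eF el /= => /eqP; rewrite subr_eq0 => /eqP e.
  by rewrite (H x y) // subrr.
have [d2 e2] := tr_represents m; exists d2; split; apply: tr_ext => b.
- have := em (b, 0); rewrite eF el /= comp0l comp0r tr0 !subr0 => eb.
  by rewrite -compA e2 eb -!compA trC compA.
- have := em (0, b); rewrite eF el /= !(comp0l, comp0r) tr0 !sub0r linearN.
  by move=> /oppr_inj eb; rewrite -compA trC -compA e2 eb.
Qed.

(** The morphism w compares each object of c with the preceding one of cx; going
    up w and down delta alternately, the trace slides one square at a time from
    the left end of the ladder to its right end. *)
Lemma trace_slide n A E F X' X E' (c : chain n A E) (a : Mor E F) (g : Mor X' X)
    (cx : chain n X E') (w0 : Mor A X') (wF : Mor F E')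
    (w : cmaps (csnoc c a) (ccons g cx)) (d0 : Mor X (S A)) (e : Mor E' (S E))
    (delta : cmaps cx (cmap S c)) :
  cmaps_commute w0 wF w -> cmaps_commute d0 e delta ->
  tr (d0 \c g \c w0) = tr (e \c wF \c a).
Proof.
elim: n A X' X c g cx w0 w d0 delta => [|n IH] A X' X c g cx w0 w d0 delta /=.
  case: w => w1 [] /= [H1 H2] H3.
  change (w1 \c c = g \c w0) in H1; change (wF \c a = cx \c w1) in H2.
  by rewrite -!compA H2 -H1 compA -trC (compA e) H3 -compA.
case: c g cx w delta => B [f c] g [Z [h cx]] [w1 w] [d1 delta] /= [H1 H2] [H3 H4].
rewrite -(IH _ _ _ _ _ _ _ _ _ _ H2 H4).
by rewrite -!compA -H1 compA -trC compA -H3 !compA.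
Qed.

(** The hypothesis on y provides the ladder that extends x and y, where sx x
    stands for the suspension of x; the next one evaluates the trace at the
    right end of this ladder. *)
Lemma exists_serre_map n A1 A2 E F G X2 E' F' Q Q' (f1 : Mor A1 A2) (g1 : Mor (S A1) X2)
    (c : chain n A2 E) (cx : chain n X2 E') (a : Mor E F) (b : Mor F G)
    (a' : Mor E' F') (e : Mor E' (S E)) (q : Mor (S E) Q) (q' : Mor E' Q')
    (r : Mor Q' Q) (sx : Mor A2 (S A1) -> Mor G F') :
  pexact g1 (csnoc cx q') -> pexact (fmap S f1) (csnoc (cmap S c) q) ->
  q \c e = r \c q' ->
  (forall x (y : Mor (cmid (csnoc (csnoc c a) b)) X2),
     y \c chead (csnoc (csnoc c a) b) = g1 \c x ->
     exists phi : cmaps (ctail (csnoc (csnoc c a) b)) (csnoc cx a'),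
       cmaps_commute y (sx x) phi) ->
  (forall x m, sx x \c b = a' \c m -> tr (e \c m \c a) = tr (x \c f1)) ->
  exists (d2 : Mor X2 (S A2)) (delta : cmaps cx (cmap S c)),
    cmaps_commute d2 e delta /\ d2 \c g1 = fmap S f1.
Proof.
case: n c cx => [|n] c cx exx exc qe ladder ends.
  have [|d2 [e1 e2]] := serre_extension (f1 := f1) (f2 := c) (g1 := g1) (g2 := cx)
      (d1 := idmor _) (d3 := e).
    move=> x y /ladder [[m []] [H1 H2]].
    by rewrite comp1m -(ends _ _ H2) -!compA -H1.
  by exists d2, tt; split=> //; rewrite e1 compm1.
have [d3 [delta com]] := lift_chain (proj2 exx) (proj2 exc) qe.
have [|d2 [e1 e2]] := serre_extension (f1 := f1) (f2 := chead c) (g1 := g1)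
    (g2 := chead cx) (d1 := idmor _) (d3 := d3).
  move=> x y /ladder [phi com'].
  have [m [w [H1 H2]]] := commute_csnoc com'.
  rewrite comp1m -(ends _ _ H2).
  have [X3 [g2 [cx' ecx]]] := ccons_surj cx; subst cx.
  by rewrite -(trace_slide H1 com).
exists d2, (d3, delta); rewrite e1 compm1; split=> //.
Qed.

End Serre.

(** * Commutation of the Serre functor with the suspension *)

Section Commutation.
Variables (k : fieldType) (C : addcat k) (S : right_serre C).
Variables (Sig : automorphism C) (eps : k) (eps0 : eps != 0).
Implicit Types A B W : C.

(** This determines e, as every map Sigma A -> Sigma S A is some Sigma h. *)
Definition twisted_trace A (e : Mor (Sig (S A)) (S (Sig A))) : Prop :=
  forall h : Mor A (S A), tr (e \c fmap Sig h) = eps * tr h.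

Lemma exists_twisted_trace A : exists e, twisted_trace (A := A) e.
Proof.
have [F eF] := linear_lfun (@aut_linear _ _ Sig A (S A)).
have [|l el] := linear_lfun (f := fun h : Mor A (S A) => eps * tr h : k^o).
  by move=> a u v; rewrite tr_linear mulrDr [in RHS]/GRing.scale /= mulrCA.
have [|m em] := factor_through (f := F) (l := l).
  move=> h; rewrite eF -(fmap0 _ _ (@aut_linear _ _ Sig)) => /sig_faithful ->.
  by rewrite linear0.
have [e ee] := tr_represents S m; exists e => h.
by rewrite ee -eF em el.
Qed.

Lemma twisted_trace_natural A B (f : Mor A B) eA eB :
  twisted_trace (A := A) eA -> twisted_trace (A := B) eB ->
  eB \c fmap Sig (fmap S f) = fmap S (fmap Sig f) \c eA.
Proof.
move=> tA tB; apply: tr_ext => b; have [h ->] := sig_full b.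
by rewrite -compA -fmapM tB trC -compA trC -compA -fmapM tA.
Qed.

(** Composition with e is bijective on maps out of each Sigma W, since both
    Hom(Sigma W, Sigma S A) and Hom(Sigma W, S Sigma A) are dual to
    Hom(A, W). *)
Lemma twisted_trace_iso A (e : Mor (Sig (S A)) (S (Sig A))) :
  twisted_trace e -> is_iso e.
Proof.
move=> te.
have surj W (y : Mor W (S (Sig A))) : exists x, e \c x = y.
  have [W' eW] := sig_surj Sig W; subst W.
  have [|l el] := linear_lfun
      (f := fun b : Mor A W' => eps^-1 * tr (y \c fmap Sig b) : k^o).
    move=> a u v; rewrite aut_linear compDr compZr tr_linear mulrDr.
    by rewrite [in RHS]/GRing.scale /= mulrCA.
  have [x ex] := tr_represents S l; exists (fmap Sig x).
  apply: tr_ext => b; have [h ->] := sig_full b.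
  by rewrite -compA -fmapM te ex el mulrA divff ?mul1r.
have inj W (x : Mor W (Sig (S A))) : e \c x = 0 -> x = 0.
  have [W' eW] := sig_surj Sig W; subst W.
  have [x' ->] := sig_full x => ex.
  rewrite (_ : x' = 0); first exact/fmap0/aut_linear.
  apply: tr_nondegenerate => b.
  have := te (x' \c b); rewrite fmapM compA ex comp0l tr0 => /esym/eqP.
  by rewrite mulf_eq0 (negbTE eps0) => /eqP.
have [z ez] := surj _ (idmor _); exists z; split=> //.
apply/eqP; rewrite -subr_eq0; apply/eqP/inj.
by rewrite compDr compNr compA ez comp1m compm1 subrr.
Qed.

Lemma exists_serre_commutation :
  exists (z : forall A, Mor (S (Sig A)) (Sig (S A)))
         (e : forall A, Mor (Sig (S A)) (S (Sig A))),
  [/\ forall A, twisted_trace (e A),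
      forall A, e A \c z A = idmor _, forall A, z A \c e A = idmor _
    & forall A B (f : Mor A B),
        z B \c fmap S (fmap Sig f) = fmap Sig (fmap S f) \c z A].
Proof.
pose e A := proj1_sig
  (constructive_indefinite_description _ (exists_twisted_trace A)).
have te A : twisted_trace (e A).
  by rewrite /e; case: constructive_indefinite_description.
pose z A := proj1_sig
  (constructive_indefinite_description _ (twisted_trace_iso (te A))).
have zE A : z A \c e A = idmor _ /\ e A \c z A = idmor _.
  by rewrite /z; case: constructive_indefinite_description.
have ze A := (zE A).1; have ez A := (zE A).2.
exists z, e; split=> // A B f.
have enat := twisted_trace_natural f (te A) (te B).
by rewrite -[RHS]comp1m -(ze B) -!compA (compA (e B)) enat -!compA ez compm1.
Qed.

End Commutation.

(** * The Serre functor preserves angles *)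

Section SerreAngles.
Variables (k : fieldType) (C : addcat k) (d : nat) (Sig : automorphism C).
Variables (Theta : sigma_seq d.+1 Sig -> Prop) (C_ang : angulated Theta).
Variable (S : right_serre C).
Implicit Types A B X : C.

Lemma serre_pexact n A B E (p : Mor A B) (c : chain n B E) :
  pexact p c -> pexact (fmap S p) (cmap S c).
Proof.
elim: n A B p c => [|n IH] A B p c.
  by move=> ex; apply/(weak_kernel_exact2 C_ang)/serre_weak_kernel.
case=> ex1 ex2; split; last exact: IH.
by apply/(weak_kernel_exact2 C_ang)/serre_weak_kernel.
Qed.

Lemma rotated_N3 A0 A1 A2 X0 X1 X2 (f0 : Mor A0 A1) (f1 : Mor A1 A2)
    (c : chain d A2 (Sig A0)) (g0 : Mor X0 X1) (g1 : Mor X1 X2)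
    (cx : chain d X2 (Sig X0)) :
  let s := (-1) ^+ d.+1 in
  let c2 := csnoc (csnoc c (s *: fmap Sig f0)) (s *: fmap Sig f1) in
  Theta (SigmaSeq (ccons f0 (ccons f1 c))) ->
  Theta (SigmaSeq (ccons g0 (ccons g1 cx))) ->
  forall (x : Mor A2 X1) (y : Mor (cmid c2) X2), y \c chead c2 = g1 \c x ->
  exists phi : cmaps (ctail c2) (csnoc cx (s *: fmap Sig g0)),
    cmaps_commute y (fmap Sig x) phi.
Proof.
move=> s c2 TA TX x y e.
have T2 : Theta (SigmaSeq c2) := proj1 (N2 C_ang _) (proj1 (N2 C_ang _) TA).
have TX1 := proj1 (N2 C_ang _) TX.
have [B [f [c' ec]]] := ccons_surj c2.
move: y e T2; rewrite ec => y e T2.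
exact: (N3 (f0 := f) (c := c') (g0 := g1)
  (c' := csnoc cx (s *: fmap Sig g0)) C_ang T2 TX1 e).
Qed.

Lemma serre_angle A0 A1 A2 (f0 : Mor A0 A1) (f1 : Mor A1 A2)
    (c : chain d A2 (Sig A0)) (z : forall A, Mor (S (Sig A)) (Sig (S A)))
    (e : forall A, Mor (Sig (S A)) (S (Sig A))) :
  (forall A, twisted_trace ((-1) ^+ d.+1) (e A)) ->
  (forall A, e A \c z A = idmor _) -> (forall A, z A \c e A = idmor _) ->
  (forall A B (f : Mor A B),
     z B \c fmap S (fmap Sig f) = fmap Sig (fmap S f) \c z A) ->
  Theta (SigmaSeq (ccons f0 (ccons f1 c))) ->
  Theta (SigmaSeq (cpost (cmap S (ccons f0 (ccons f1 c))) (z A0))).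
Proof.
move=> te ez ze znat TA.
have enat : e A1 \c fmap Sig (fmap S f0) = fmap S (fmap Sig f0) \c e A0.
  exact: twisted_trace_natural.
have iz A : is_iso (z A) by exists (e A).
have [cx0 TX] := N1_first C_ang (fmap S f0).
have [X2 [g1 [cx ecx]]] := ccons_surj cx0; subst cx0.
have exX := angle_pexact C_ang TX.
have exS : pexact (fmap S f0) (cmap S (csnoc (ccons f1 c) (fmap Sig f0))).
  exact/serre_pexact/(angle_pexact C_ang TA).
rewrite cmap_csnoc in exS.
have exY : pexact (fmap S f0)
    (csnoc (cpost (cmap S (ccons f1 c)) (z A0)) (fmap Sig (fmap S f0))).
  by apply: (pexact_cpost (iz A0) (iz A1)) exS; rewrite znat.
have sq (b : k) : (-1) ^+ d.+1 * ((-1) ^+ d.+1 * b) = b.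
  by rewrite mulrA -expr2 sqrr_sign mul1r.
have [||d2 [delta [com e2]]] := exists_serre_map (f1 := f1) (g1 := g1) (c := c)
  (cx := cx) (q := fmap S (fmap Sig f0))
  (e := e A0) (r := e A1) (proj2 exX) (proj2 exS) _ (rotated_N3 TA TX) _.
- by rewrite enat.
- move=> x m; have [m' ->] := sig_full m.
  rewrite compZr compZl => /(scalerI _).
  rewrite signr_eq0 => /(_ isT).
  rewrite -!fmapM => /sig_faithful ->.
  by rewrite compZr trZ -compA -fmapM te sq trC.
have [psi] := commute_cpost (z A0) com; rewrite ze => com'.
have inv := weak_iso_invariant (c := ccons g1 cx)
  (c' := cpost (cmap S (ccons f1 c)) (z A0)) (phi := (d2, psi)) exX exY.
apply: (inv _ _ (angle_invariant C_ang (fmap S f0)) TX).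
by split=> //; rewrite compm1.
Qed.

End SerreAngles.

Theorem theorem1p4 (k : closedFieldType) (C : addcat k)
    (C_ks : krull_schmidt C) (d : nat) (d_ge1 : (1 <= d)%N)
    (Sig : automorphism C) (Theta : sigma_seq d Sig -> Prop)
    (C_ang : angulated Theta) (S : right_serre C) :
  exists zeta : forall A : C, Mor (S (Sig A)) (Sig (S A)),
    angulated_functor Theta zeta.
Proof.
case: d d_ge1 Theta C_ang => // d _ Theta C_ang.
have eps0 : (-1) ^+ d.+1 != 0 :> k by rewrite signr_eq0.
have [z [e [te ez ze znat]]] := exists_serre_commutation S Sig eps0.
exists z; split; first by move=> A B f g; apply/fmapD/serre_linear.
  by split=> [A|A B f]; [exists (e A); rewrite ez ze | apply: znat].
case=> A0 c0; have [A1 [f0 [c1 e0]]] := ccons_surj c0; subst c0.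
have [A2 [f1 [c e1]]] := ccons_surj c1; subst c1.
exact: (serre_angle C_ang te).
Qed.
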